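(* There exists $k_0$ such that for every integer $k\ge k_0$, the minimum degree of every bipartite outer $k$-planar graph is at most $2\sqrt{\frac{8}{11}}\sqrt{k}+2$.
   Context: A convex geometric graph is a drawing of a finite simple graph in the plane whose vertex set is a set of points in convex position (no three collinear) and whose edges are drawn as straight-line segments between their endpoints. Two edges cross if they share a point in their relative interiors. The drawing is $k$-plane if each edge crosses at most $k$ other edges. A graph is outer $k$-planar if it admits a convex geometric $k$-plane drawing. A bipartite outer $k$-planar graph is an outer $k$-planar graph that is bipartite; the two color classes may appear in any order along the convex hull. *)

(* Defs.v *)
From HB Require Import structures.
From mathcomp Require Import all_boot all_order all_algebra.
From mathcomp Require Import boolp classical_sets set_interval reals convex.

Set Implicit Arguments.
Unset Strict Implicit.
Unset Printing Implicit Defensive.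

Import Order.TTheory GRing.Theory Num.Theory.
Local Open Scope ring_scope.

(* A finite simple graph is a symmetric irreflexive relation [e] on a finType
   [T]; its edges are the unordered pairs [[set x; y]] with [e x y]. *)
Section Graph.
Variables (T : finType) (e : rel T).

Definition edges : {set {set T}} := [set [set x; y] | x in T, y in T & e x y].

Definition degree (v : T) : nat := #|[set u | e v u]|.

(* Degrees are smaller than [#|T|], so the default value [#|T|] is irrelevant
   as soon as there is a vertex; the graph without vertices gets 0. *)
Definition min_degree : nat := \big[minn/#|T|]_(v : T) degree v.

Definition bipartite : Prop :=
  exists c : T -> bool, forall x y, e x y -> c x != c y.

End Graph.

Section Drawing.
Variable R : realType.
Local Notation plane := 'rV[R]_2.

Definition convex_hull (A : set plane) : set plane :=
  smallest (@convex_set R plane) A.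

Definition collinear (a b c : plane) : Prop :=
  (\rank (col_mx (b - a) (c - a)) <= 1)%N.

Section Vertices.
Variables (T : finType) (p : T -> plane).

(* The last clause implies the first two. *)
Definition convex_position : Prop :=
  [/\ injective p,
      forall x y z, x != y -> y != z -> x != z -> ~ collinear (p x) (p y) (p z)
    & forall v, ~ convex_hull (p @` [set u | u != v])%classic (p v)].

(* For [E = [set x; y]] with [x != y], the open segment from [p x] to [p y];
   the two ways of naming the endpoints give the same points. *)
Definition edge_interior (E : {set T}) : set plane :=
  [set q | exists x y : T, E = [set x; y]%SET /\
     exists2 t : R, 0 < t < 1 & q = (1 - t) *: p x + t *: p y]%classic.

Definition crosses (E F : {set T}) : Prop :=
  E <> F /\ (edge_interior E `&` edge_interior F !=set0)%classic.

Definition k_plane (k : nat) (e : rel T) : Prop :=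
  forall E, E \in edges e ->
    (#|[set F in edges e | `[< crosses E F >]]| <= k)%N.

End Vertices.

Definition outer_k_planar (k : nat) (T : finType) (e : rel T) : Prop :=
  exists p : T -> plane, convex_position p /\ k_plane p k e.

End Drawing.

(* Main.v *)
Require Import Defs.
From mathcomp Require Import boolp classical_sets reals convex.
From mathcomp Require Import interval_inference.
From mathcomp Require Import all_boot all_order all_algebra.
From mathcomp Require Import zify ring lra.
(** Write d for the minimum degree, with d >= 3. It suffices to find an edge ab
    crossed by at least 11/32 * (d - 2)^2 others, since this number is then at
    most k.

    Points in convex position carry a total cyclic order, the counterclockwise
    one ([ccw_cyclic_order]), and two chords cross as soon as the endpoints of
    the second lie on different sides of the first ([chords_cross]). From then
    on the argument only speaks of the cyclic order. Let S be the set of the i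
    vertices to the left of the edge from a to b. Every edge between S and the
    other side of ab crosses ab, so the number of crossings is at least
    i * d - N, where N sums over v in S the number of neighbours of v in
    S + {a, b}.

    Fix a threshold t and choose ab, among all edges with at least t vertices
    on their left, with i minimal. There are two upper bounds for N.
    - Bipartiteness: if S has p vertices of one colour and q of the other, then
      N <= 2pq + p + q <= i^2/2 + i ([sum_inner_bipartite]).
    - Minimality: any other edge with both ends in S + {a, b} cuts off fewer
      than t vertices of S, so a vertex of S has at most t neighbours on each
      side along S, and fewer near the ends of S. This gives
      N <= 2it - t^2 + t ([sum_inner_short]).
    The first bound leaves i * (d - 1) - i^2/2 crossings, a concave function of
    i that takes equal values at t and at 2(d - 1) - t; so it is good for i
    between these two. The second leaves i * (d - 2t) + t^2 - t, which increases
    with i if 2t <= d, and is good beyond 2(d - 1) - t. To leading order the two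
    worst cases are, with t = c * d, c * (1 - c/2) * d^2 and
    ((2 - c) * (1 - 2c) + c^2) * d^2. For c = 9/20 these are 0.34875 * d^2 and
    0.3575 * d^2, both above 11/32 = 0.34375, and the lower-order terms do no
    harm ([outer_sum_bound]). *)

Set Implicit Arguments.
Unset Strict Implicit.
Unset Printing Implicit Defensive.

Import Order.TTheory GRing.Theory Num.Theory.
Local Open Scope ring_scope.

(** * Total cyclic orders and their arcs *)

Record cyclic_order (T : finType) (C : T -> T -> T -> bool) : Prop :=
  CyclicOrder {
    cyc_rot : forall x y z, C x y z -> C y z x;
    cyc_asym : forall x y z, C x y z -> ~~ C x z y;
    cyc_trans : forall x y z w, C x y z -> C x z w -> C x y w;
    cyc_total : forall x y z,
      x != y -> y != z -> x != z -> C x y z || C x z y }.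

Definition arc (T : finType) (C : T -> T -> T -> bool) (x y : T) : {set T} :=
  [set w | C x w y].

(** Reversal exchanges the arc from x to y with the one from y to x, so each
    statement about one end of an arc gives the one about the other end. *)
Lemma cyclic_order_rev (T : finType) (C : T -> T -> T -> bool) :
  cyclic_order C -> cyclic_order (fun x y z => C z y x).
Proof.
move=> [rot asym trans total]; split=> x y z.
- by move=> /rot /rot.
- by move=> /asym; apply: contra => /rot.
- by move=> w /rot /rot Hxzy /rot /rot Hxwz; apply/rot/(@trans _ _ z).
- move=> xy yz xz; have /orP[->//|/rot/rot->] : C z y x || C z x y.
    by rewrite total // eq_sym.
  by rewrite orbT.
Qed.

Section Arcs.
Variables (T : finType) (C : T -> T -> T -> bool).
Hypothesis CO : cyclic_order C.

Let rot := cyc_rot CO.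
Let asym := cyc_asym CO.
Let trans := cyc_trans CO.
Let total := cyc_total CO.

Lemma cyc_neq12 x y z : C x y z -> x != y.
Proof.
move=> Cxyz; apply/eqP => exy; move: Cxyz; rewrite -{}exy => H.
by have := asym (rot H); rewrite H.
Qed.

(** An edge with both ends in the closed arc from b to a, other than ab, cuts
    off a shorter arc: this is where minimality of ab gets applied. *)
Lemma arc_proper b v a u :
  C b v a -> u \in a |: arc C v a -> arc C v u \proper arc C b a.
Proof.
move=> Cbva ua; apply/properP; split; last first.
  by exists v; rewrite inE //; apply/negP => /cyc_neq12; rewrite eqxx.
apply/subsetP => w; rewrite !inE => Cvwu.
have Cvwa : C v w a.
  by move: ua; rewrite !inE => /orP[/eqP<-|] //; apply: trans.
by apply/rot/(@trans _ _ v); [apply/rot/rot | apply/rot/rot].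
Qed.

(** The arcs starting at v form a chain for inclusion, so the size of the arc
    from v to u tells the position of u when counting from v. *)
Lemma arc_card_inj v :
  {in [pred u | u != v] &, injective (fun u => #|arc C v u|)}.
Proof.
have lt x y : C v x y -> (#|arc C v x| < #|arc C v y|)%N.
  move=> Cvxy; apply/proper_card/properP; split.
    by apply/subsetP => w; rewrite !inE => Cvwx; apply: trans Cvxy.
  exists x; rewrite inE //.
  by apply/negP => /[dup] /asym; case: (C v x x).
move=> x y; rewrite !inE => xv yv /= exy; apply/eqP/negPn/negP => xy.
have /orP[] : C v x y || C v y x by rewrite total // eq_sym.
  by move=> /lt; rewrite exy ltnn.
by move=> /lt; rewrite exy ltnn.
Qed.

Lemma card_near v t (N : {set T}) :
  (forall u, u \in N -> u != v /\ (#|arc C v u| < t)%N) -> (#|N| <= t)%N.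
Proof.
move=> nearN; rewrite cardE -(size_map (fun u => #|arc C v u|)).
rewrite -[leqRHS](size_iota 0); apply: uniq_leq_size.
  rewrite map_inj_in_uniq ?enum_uniq // => x y; rewrite !mem_enum.
  by move=> /nearN[xv _] /nearN[yv _]; apply: arc_card_inj.
by move=> j /mapP[u]; rewrite mem_enum => /nearN[_ ut] ->; rewrite mem_iota.
Qed.

(** When v runs over an arc, its position counted from the start of the arc
    takes each value below the size of the arc exactly once. *)
Lemma sum_arc b a (F : nat -> nat) :
  (\sum_(v in arc C b a) F #|arc C b v| = \sum_(0 <= j < #|arc C b a|) F j)%N.
Proof.
set S := arc C b a; pose f v := #|arc C b v|.
have fS : perm_eq [seq f v | v <- enum S] (index_iota 0 #|S|).
  have uf : uniq [seq f v | v <- enum S].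
    rewrite map_inj_in_uniq ?enum_uniq // => x y; rewrite !mem_enum !inE.
    move=> /cyc_neq12 bx /cyc_neq12 yb.
    by apply: arc_card_inj; rewrite inE eq_sym.
  apply: uniq_perm => //; first exact: iota_uniq.
  apply: (uniq_min_size uf _ _).2; last first.
    by rewrite size_map -cardE size_iota subn0.
  move=> j /mapP[v]; rewrite mem_enum inE => Cbva ->.
  rewrite mem_index_iota /=; apply/proper_card/properP; split.
    by apply/subsetP => w; rewrite !inE => Cbwv; apply: trans Cbva.
  by exists v; rewrite inE //; apply/negP => /[dup] /asym; case: (C b v v).
by rewrite -(perm_big _ fS) /= big_map big_enum.
Qed.

Lemma cyc_cover a b u : a != b -> u \in [set a; b] :|: arc C b a :|: arc C a b.
Proof.
move=> ab; rewrite !inE; case: eqVneq => //= ua; case: eqVneq => //= ub.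
have /orP[/rot->//|->] : C a b u || C a u b by rewrite total // eq_sym.
by rewrite orbT.
Qed.

Lemma arc_cover a b v u : C b v a -> u \in [set a; b] :|: arc C b a -> u != v ->
  (u \in a |: arc C v a) || (u \in b |: arc C b v).
Proof.
move=> Cbva; rewrite !inE; case: eqVneq => //= ua; case: eqVneq => /= [_|ub].
  by rewrite orbT.
move=> Cbua uv; have /orP[->|Cbvu] : C b u v || C b v u.
- by rewrite total // ?(cyc_neq12 Cbva) // eq_sym.
- by rewrite orbT.
have va : v != a by apply: cyc_neq12 (rot Cbva).
have /orP[->//|Cvau] : C v u a || C v a u by rewrite total // eq_sym.
have := trans (rot (rot Cbvu)) (rot (rot Cvau)).
by move=> /asym; rewrite (rot Cbua).
Qed.

End Arcs.

Lemma arc_ends_disjoint (T : finType) (C : T -> T -> T -> bool) a b u :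
  cyclic_order C -> u \in arc C b a -> u \notin arc C a b.
Proof.
by move=> CO; rewrite !inE => /(cyc_rot CO)/(cyc_rot CO)/(cyc_asym CO).
Qed.

(** Positions closer than t to an end of an arc leave less room than t; the
    saving over i * t is the t^2 - t halved here, which is needed to reach the
    constant 11/32. *)
Lemma sum_minn t i : (t <= i)%N ->
  (2 * (\sum_(0 <= j < i) minn t j.+1) + t * t = 2 * i * t + t)%N.
Proof.
have base : (2 * (\sum_(0 <= j < t) j.+1) = t * t + t)%N.
  by elim: t => [|t IH]; rewrite ?big_nil // big_nat_recr //= mulnDr IH; lia.
move=> /subnK <-; elim: (i - t)%N => [|m IH].
  rewrite add0n (eq_big_nat _ _ (F2 := succn)) => [|j /andP[_ jt]].
    by rewrite base; lia.
  exact/minn_idPr.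
rewrite addSn big_nat_recr //= (minn_idPl _); first lia.
by rewrite leqW // leq_addl.
Qed.

(** * Vertices on one side of a shortest long edge *)

Section HeavyEdge.
Variables (T : finType) (C : T -> T -> T -> bool).
Hypothesis CO : cyclic_order C.
Variables (e : rel T) (c : T -> bool).
Hypotheses (e_sym : symmetric e) (bip : forall x y, e x y -> c x != c y).

(** For a cyclic order that comes from points in convex position, [arc C b a]
    is the set of the vertices to the left of the chord from a to b. Neighbours
    in its closure are the inner ones; edges to outer neighbours cross ab. *)
Definition inner_degree a b v := #|[set u in [set a; b] :|: arc C b a | e v u]|.
Definition outer_degree a b v := #|[set u in arc C a b | e v u]|.
Definition long_edge t a b := e a b && (t <= #|arc C b a|)%N.

Lemma edge_neq x y : e x y -> x != y.
Proof. by move=> /bip; apply: contraNneq => ->. Qed.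

Lemma degree_split a b v : a != b ->
  (degree e v <= inner_degree a b v + outer_degree a b v)%N.
Proof.
move=> ab; apply: leq_trans (leq_card_setU _ _); apply/subset_leq_card.
apply/subsetP => u; have := cyc_cover CO u ab.
by rewrite !inE => /orP[-> ->|-> ->] //; rewrite orbT.
Qed.

(** A vertex v of the arc is adjacent only to the vertices of the other colour
    in the arc, and to at most one of a and b, as these have different colours.
    With p and q vertices of the two colours the sum is at most
    p(q + 1) + q(p + 1), and 4pq <= (p + q)^2. *)
Lemma sum_inner_bipartite a b : e a b ->
  (2 * (\sum_(v in arc C b a) inner_degree a b v)
     <= #|arc C b a| * #|arc C b a| + 2 * #|arc C b a|)%N.
Proof.
move=> eab; set S := arc C b a.
pose opp x := #|[set u in S | c u == x]|.
have inner_le v : v \in S -> (inner_degree a b v <= (opp (~~ c v)).+1)%N.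
  move=> vS; pose w := if c a != c v then a else b.
  apply: (@leq_trans #|w |: [set u in S | c u == ~~ c v]|).
    apply/subset_leq_card/subsetP => u; rewrite !inE => /andP[uab evu].
    have cu : c u = ~~ c v by move: (bip evu); case: (c v); case: (c u).
    rewrite cu eqxx andbT; move: uab; case: (C b u a); rewrite ?orbT // !orbF.
    rewrite /w => /orP[]/eqP eu; first by rewrite -eu cu; case: (c v) => /=.
    by have := bip eab; rewrite -eu cu; case: (c a); case: (c v) => /=.
  by rewrite cardsU1 -add1n leq_add2r leq_b1.
have cardS : #|S| = (opp true + opp false)%N.
  rewrite -(cardsID [set u | c u] S) /opp; congr (_ + _)%N.
    by apply: eq_card => u; rewrite !inE; case: (c u).
  by apply: eq_card => u; rewrite !inE andbC; case: (c u).
have sum_opp x : (\sum_(v in S | c v == x) (opp (~~ c v)).+1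
    = opp x * (opp (~~ x)).+1)%N.
  rewrite (eq_bigr (fun=> (opp (~~ x)).+1)) => [|v /andP[_ /eqP->] //].
  by rewrite sum_nat_const [X in (_ = X * _)%N]cardsE.
have : (\sum_(v in S) inner_degree a b v <= \sum_(v in S) (opp (~~ c v)).+1)%N.
  exact: leq_sum.
rewrite [leqRHS](bigID (fun v => c v == true)) /=.
rewrite sum_opp [X in (_ <= _ + X)%N](_ : _ = \sum_(v in S | c v == false)
  (opp (~~ c v)).+1)%N; last by apply: eq_bigl => v; case: (c v).
rewrite sum_opp cardS /=; set s := (\sum_(_ in _) _)%N.
have := (nat_AGM2 (opp true) (opp false)).1; rewrite -mulnn.
by move: (opp true) (opp false) s => p q s; lia.
Qed.

(** By minimality, the edges from v to its neighbours between v and a, including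
    a, cut off fewer than t vertices each; as these numbers differ, there are at
    most t such neighbours. There are also at most as many as there are vertices
    between v and a, including a. The same holds between b and v, and both
    bounds get summed over the positions of v. *)
Lemma sum_inner_short t a b : e a b -> (t <= #|arc C b a|)%N ->
  (forall x y, long_edge t x y -> (#|arc C b a| <= #|arc C y x|)%N) ->
  (\sum_(v in arc C b a) inner_degree a b v + t * t
     <= 2 * #|arc C b a| * t + t)%N.
Proof.
move=> eab tS minab.
have short x y : e x y -> arc C y x \proper arc C b a -> (#|arc C y x| < t)%N.
  move=> exy /proper_card; rewrite !ltnNge; apply: contra => txy.
  by apply: minab; rewrite /long_edge exy.
have COr := cyclic_order_rev CO.
have inner_le v : v \in arc C b a ->
    (inner_degree a b v <= minn t #|arc C v a|.+1 + minn t #|arc C b v|.+1)%N.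
  rewrite inE => Cbva.
  apply: (@leq_trans (#|[set u in a |: arc C v a | e v u]|
                      + #|[set u in b |: arc C b v | e v u]|)).
    apply: leq_trans (leq_card_setU _ _); apply/subset_leq_card/subsetP => u.
    rewrite !inE => /andP[uab evu]; rewrite evu !andbT.
    have := arc_cover CO Cbva (u := u); rewrite !inE; apply=> //.
    by rewrite eq_sym edge_neq.
  apply: leq_add; rewrite leq_min; apply/andP; split.
  - apply: (card_near CO (v := v)) => u; rewrite inE => /andP[ua evu].
    rewrite eq_sym edge_neq //; split=> //.
    by apply: short; [rewrite e_sym | apply: arc_proper].
  - apply: (@leq_trans #|a |: arc C v a|).
      by apply/subset_leq_card/subsetP => u; rewrite inE => /andP[].
    by rewrite cardsU1 -add1n leq_add2r leq_b1.
  - apply: (card_near COr (v := v)) => u; rewrite inE => /andP[ub evu].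
    rewrite eq_sym edge_neq //; split=> //.
    by apply: (short _ _ evu); apply: (arc_proper COr Cbva).
  - apply: (@leq_trans #|b |: arc C b v|).
      by apply/subset_leq_card/subsetP => u; rewrite inE => /andP[].
    by rewrite cardsU1 -add1n leq_add2r leq_b1.
have : (\sum_(v in arc C b a) inner_degree a b v <= \sum_(v in arc C b a)
    (minn t #|arc C v a|.+1 + minn t #|arc C b v|.+1))%N by exact: leq_sum.
rewrite big_split /=.
have -> : (\sum_(v in arc C b a) minn t #|arc C v a|.+1
    = \sum_(0 <= j < #|arc C b a|) minn t j.+1)%N.
  exact: (sum_arc COr a b (fun j => minn t j.+1)).
rewrite (sum_arc CO b a (fun j => minn t j.+1)).
have := sum_minn tS; lia.
Qed.

(** There are more than d vertices, so one of the two sides of any edge has at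
    least half of d - 1 of them, rounded up. *)
Lemma exists_long t d : (0 < d)%N -> (2 * t <= d)%N ->
  (forall v, d <= degree e v)%N -> (0 < #|T|)%N -> exists a b, long_edge t a b.
Proof.
move=> d0 td dmin /card_gt0P[x _].
have /card_gt0P[y] : (0 < degree e x)%N by apply: leq_trans (dmin x).
rewrite inE => exy.
have dT : (degree e x < #|T|)%N.
  rewrite -cardsT; apply/proper_card/properP; split; first exact/subsetP.
  by exists x; rewrite inE //; apply/negP => /edge_neq; rewrite eqxx.
have Tle : (#|T| <= 2 + #|arc C y x| + #|arc C x y|)%N.
  rewrite -cardsT (_ : [set: T] = [set x; y] :|: arc C y x :|: arc C x y).
    apply: leq_trans (leq_card_setU _ _) _; rewrite leq_add2r.
    apply: leq_trans (leq_card_setU _ _) _; rewrite leq_add2r.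
    by rewrite cards2; case: (_ != _).
  by apply/setP => u; rewrite cyc_cover ?inE ?edge_neq.
have dx := dmin x.
case: (leqP t #|arc C y x|) => [h|h].
  by exists x, y; rewrite /long_edge exy.
exists y, x; rewrite /long_edge e_sym exy /=; lia.
Qed.

End HeavyEdge.

(** Here s stands for the number of edges that leave the arc of size i on the
    other side of ab, and n for the sum of the inner degrees. The degree sum
    i * d is at most n + s, and the two bounds on n are played against each
    other at i = 2(d - 1) - t, for t the integer part of 9d/20. *)
Lemma outer_sum_bound (i d t n s : nat) :
  (3 <= d)%N -> (20 * t <= 9 * d)%N -> (9 * d < 20 * t + 20)%N -> (t <= i)%N ->
  (i * d <= n + s)%N -> (2 * n <= i * i + 2 * i)%N ->
  (n + t * t <= 2 * i * t + t)%N ->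
  (11 * (d - 2) ^ 2 <= 32 * s)%N.
Proof.
move=> d3 td dt ti degs bipn shortn.
have [D dD] : exists D, d = D.+2 by exists d.-2; lia.
subst d; rewrite subSS subSS subn0 -mulnn.
have D0 : (0 <= D%:Z)%R by lia.
have [i_small|i_large] := leqP i (2 * D.+1 - t).
  (* Concavity in i: the value at i is at least the common value at the two
     ends t and 2(d - 1) - t. *)
  have P1 : (0 <= (i%:Z - t%:Z) * (2 * D%:Z + 2 - t%:Z - i%:Z))%R
    by rewrite mulr_ge0; lia.
  (* Concavity in t: 20t lies between 9d - 19 and 9d, that is, between 9D - 1
     and 9D + 18. *)
  have P2 : (0 <= (20 * t%:Z - 9 * D%:Z + 1) * (9 * D%:Z + 18 - 20 * t%:Z))%R
    by rewrite mulr_ge0; lia.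
  have P3 : (0 <= D%:Z * (20 * t%:Z - 9 * D%:Z + 1))%R
    by rewrite mulr_ge0; lia.
  have P4 : (0 <= D%:Z * (D%:Z))%R
    by rewrite mulr_ge0; lia.
  lia.
(* The bound from minimality increases with i, so i is replaced by
   2(d - 1) - t; what remains is convex in t and is bounded below by its tangent
   at 9D/20. *)
have P1 : (0 <= (i%:Z - (2 * D%:Z + 2 - t%:Z)) * (D%:Z + 2 - 2 * t%:Z))%R
    by rewrite mulr_ge0; lia.
have P2 : (0 <= (20 * t%:Z - 9 * D%:Z) ^+ 2)%R by rewrite sqr_ge0.
have P3 : (0 <= D%:Z * (9 * D%:Z + 18 - 20 * t%:Z))%R
    by rewrite mulr_ge0; lia.
have P4 : (0 <= D%:Z * (D%:Z))%R
    by rewrite mulr_ge0; lia.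
lia.
Qed.

Lemma exists_heavy_edge (T : finType) (C : T -> T -> T -> bool) (e : rel T)
    (d : nat) :
  cyclic_order C -> symmetric e -> bipartite e ->
  (3 <= d)%N -> (forall v, d <= degree e v)%N -> (0 < #|T|)%N ->
  exists a b, e a b /\
    (11 * (d - 2) ^ 2 <= 32 * \sum_(v in arc C b a) outer_degree C e a b v)%N.
Proof.
move=> CO e_sym [c bip] d3 dmin T0.
pose t := ((9 * d) %/ 20)%N.
have [td dt] : (20 * t <= 9 * d /\ 9 * d < 20 * t + 20)%N by rewrite /t; lia.
have [d0 td2] : (0 < d /\ 2 * t <= d)%N by lia.
have [a0 [b0 long0]] := exists_long CO e_sym bip d0 td2 dmin T0.
case: (@arg_minnP _ (a0, b0) (fun xy => long_edge C e t xy.1 xy.2)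
         (fun xy => #|arc C xy.2 xy.1|) long0) => -[a b] /= longab minab.
have [eab tab] := andP longab.
exists a, b; split=> //.
apply: (@outer_sum_bound #|arc C b a| d t
          (\sum_(v in arc C b a) inner_degree C e a b v)) => //.
- rewrite -big_split -sum_nat_const; apply: leq_sum => v _ /=.
  by apply: leq_trans (dmin v) _; apply: degree_split; rewrite ?(edge_neq bip).
- exact: (sum_inner_bipartite C bip).
- apply: (sum_inner_short CO e_sym bip) => // x y lxy.
  exact: (minab (x, y)).
Qed.

(** * Points in convex position *)

(** Twice the signed area of the triangle abc. *)
Definition orient (R : realType) (a b c : 'rV[R]_2) : R :=
  (b 0 0 - a 0 0) * (c 0 1 - a 0 1) - (b 0 1 - a 0 1) * (c 0 0 - a 0 0).

Lemma det_mx22 (R : realType) (M : 'M[R]_2) :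
  \det M = M 0 0 * M 1 1 - M 0 1 * M 1 0.
Proof.
rewrite (expand_det_row _ 0) big_ord_recl big_ord1 /cofactor !det_mx11 !mxE.
rewrite (_ : lift ord0 ord0 = 1); last exact: val_inj.
rewrite (_ : lift 1 0 = 0); last exact: val_inj.
by rewrite expr0 expr1 mul1r mulN1r mulrN.
Qed.

Lemma orient_eq0_collinear (R : realType) (a b c : 'rV[R]_2) :
  orient a b c = 0 -> collinear a b c.
Proof.
move=> abc0; rewrite /collinear leqNgt; apply/negP => rank2.
pose M : 'M[R]_2 := col_mx (b - a) (c - a).
have : row_free M by rewrite /row_free eqn_leq rank_leq_row.
rewrite row_free_unit unitmxE unitfE det_mx22.
have M0 j : M 0 j = (b - a) 0 j.
  by rewrite -(col_mxEu (b - a) (c - a)); congr (M _ j); apply: val_inj.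
have M1 j : M 1 j = (c - a) 0 j.
  by rewrite -(col_mxEd (b - a) (c - a)); congr (M _ j); apply: val_inj.
by rewrite !M0 !M1 !mxE -[X in X != 0]/(orient a b c) abc0 eqxx.
Qed.

Lemma plane_eq (R : realType) (u v : 'rV[R]_2) :
  u 0 0 = v 0 0 -> u 0 1 = v 0 1 -> u = v.
Proof.
move=> e0 e1; apply/rowP => -[[|[|//]] j2].
  by rewrite (_ : Ordinal j2 = 0) //; apply: val_inj.
by rewrite (_ : Ordinal j2 = 1) //; apply: val_inj.
Qed.

(** Weights are left unnormalised so that signed areas can be used directly as
    barycentric coordinates. *)
Lemma conv3_in_hull (R : realType) (A : classical_sets.set 'rV[R]_2)
    (x y z : 'rV[R]_2) (r s t : R) :
  A x -> A y -> A z -> 0 < r -> 0 < s -> 0 < t ->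
  convex_hull A ((r + s + t)^-1 *: (r *: x + s *: y + t *: z)).
Proof.
move=> Ax Ay Az r0 s0 t0 B /= [convB AB].
have conv2 u v (p q : R) : B u -> B v -> 0 < p -> 0 < q ->
    B ((p + q)^-1 *: (p *: u + q *: v)).
  move=> Bu Bv p0 q0.
  have pq0 : 0 < p + q by rewrite addr_gt0.
  have l0 : 0 <= p / (p + q) by rewrite divr_ge0 ?ltW.
  have l1 : p / (p + q) <= 1 by rewrite ler_pdivrMr // mul1r lerDl ltW.
  have := convB u v (Itv01 l0 l1).
  rewrite !classical_sets.in_setE => /(_ Bu Bv); congr B.
  by apply: plane_eq; rewrite !mxE /= /unstable.onem; field; rewrite gt_eqF.
have -> : (r + s + t)^-1 *: (r *: x + s *: y + t *: z) =
    ((r + s) + t)^-1 *: ((r + s) *: ((r + s)^-1 *: (r *: x + s *: y)) + t *: z).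
  by rewrite scalerA divff ?scale1r // gt_eqF // addr_gt0.
by apply: (conv2); rewrite ?addr_gt0 //; last exact: AB;
  apply: (conv2) => //; exact: AB.
Qed.

Lemma orient_rot (R : realType) (a b c : 'rV[R]_2) :
  orient b c a = orient a b c.
Proof. by rewrite /orient; ring. Qed.

Lemma orient_swap (R : realType) (a b c : 'rV[R]_2) :
  orient a c b = - orient a b c.
Proof. by rewrite /orient; ring. Qed.

Section Position.
Variables (R : realType) (T : finType) (p : T -> 'rV[R]_2).

Definition ccw (x y z : T) : bool := 0 < orient (p x) (p y) (p z).

(** Totality is the absence of collinear triples. Transitivity is where convex
    position matters: if xyz and xzw are counterclockwise but xyw is not, then
    x lies inside the triangle yzw, with the areas of xzw, xwy and xyz as
    barycentric coordinates. *)
Lemma ccw_cyclic_order : convex_position p -> cyclic_order ccw.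
Proof.
case=> _ ncol hull.
have total x y z : x != y -> y != z -> x != z -> ccw x y z || ccw x z y.
  move=> xy yz xz; rewrite /ccw [X in _ || (_ < X)]orient_swap oppr_gt0.
  rewrite orbC -neq_lt; apply/eqP => /orient_eq0_collinear.
  exact: ncol.
have asym x y z : ccw x y z -> ~~ ccw x z y.
  by rewrite /ccw => Cxyz; rewrite orient_swap oppr_gt0 -leNgt ltW.
split=> // [x y z|x y z w Cxyz Cxzw]; first by rewrite /ccw (orient_rot (p x)).
have [//|nCxyw] := boolP (ccw x y w).
have [xy xw] : x != y /\ x != w.
  by split; apply/eqP => E; [move: Cxyz | move: Cxzw]; rewrite /ccw /orient E;
    rewrite !subrr ?mul0r ?mulr0 subrr ltxx.
have yw : y != w.
  by apply/eqP => E; move: (asym _ _ _ Cxyz); rewrite E Cxzw.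
have Cxwy : ccw x w y by have := total x y w xy yw xw; rewrite (negPf nCxyw).
have inA u : u != x -> (p @` [set u | u != x])%classic (p u).
  by move=> ux; exists u.
have zx : z != x.
  apply/eqP => E; move: Cxyz.
  by rewrite /ccw /orient E !subrr !mulr0 subrr ltxx.
case: (hull x).
have sum0 : orient (p x) (p z) (p w) + orient (p x) (p w) (p y)
    + orient (p x) (p y) (p z) != 0.
  by apply: lt0r_neq0; apply: addr_gt0 => //; apply: addr_gt0.
rewrite [X in convex_hull _ X](_ : _ = (orient (p x) (p z) (p w)
    + orient (p x) (p w) (p y) + orient (p x) (p y) (p z))^-1 *:
  (orient (p x) (p z) (p w) *: p y + orient (p x) (p w) (p y) *: p z
    + orient (p x) (p y) (p z) *: p w)).
  by apply: conv3_in_hull => //; apply: inA; rewrite // eq_sym.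
by apply: plane_eq; apply: (mulfI sum0);
  rewrite !mxE mulVKf //; rewrite /orient; ring.
Qed.

(** By transitivity of the cyclic order the triangles adc and bcd are also
    counterclockwise. The common point divides ab in the ratio of their areas,
    and divides cd in the ratio of the areas of bca and adb; both pairs of areas
    add up to the area of the quadrilateral. *)
Lemma chords_cross a b c d : convex_position p ->
  c \in arc ccw b a -> d \in arc ccw a b ->
  (edge_interior p [set a; b] `&` edge_interior p [set c; d] !=set0)%classic.
Proof.
move=> /ccw_cyclic_order CO; rewrite !inE => Cbca Cadb.
have Cadc : ccw a d c.
  by apply: (cyc_trans CO) Cadb _; apply/(cyc_rot CO)/(cyc_rot CO).
have Cbcd : ccw b c d.
  by apply: (cyc_trans CO) Cbca _; apply/(cyc_rot CO)/(cyc_rot CO).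
pose s1 := orient (p a) (p d) (p c); pose s2 := orient (p b) (p c) (p d).
pose r1 := orient (p b) (p c) (p a); pose r2 := orient (p a) (p d) (p b).
have s1_gt0 : 0 < s1 by [].
have s2_gt0 : 0 < s2 by [].
have r1_gt0 : 0 < r1 by [].
have r2_gt0 : 0 < r2 by [].
have frac (x y : R) : 0 < x -> 0 < y -> 0 < x / (x + y) < 1.
  move=> x0 y0; have xy0 : 0 < x + y by apply: addr_gt0.
  by rewrite divr_gt0 //= ltr_pdivrMr // mul1r ltrDl.
have s_neq0 : s1 + s2 != 0 by apply: lt0r_neq0; apply: addr_gt0.
have rs : r1 + r2 = s1 + s2 by rewrite /r1 /r2 /s1 /s2 /orient; ring.
exists ((1 - s1 / (s1 + s2)) *: p a + (s1 / (s1 + s2)) *: p b); split.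
  by exists a, b; split=> //; exists (s1 / (s1 + s2)); rewrite ?frac //.
exists c, d; split=> //; exists (r1 / (r1 + r2)); first exact: frac.
have clear_denom s (x y : R) : (s1 + s2) *
    ((1 - s / (s1 + s2)) * x + s / (s1 + s2) * y) = (s1 + s2 - s) * x + s * y.
  by field.
apply: plane_eq; apply: (mulfI s_neq0); rewrite rs !mxE !clear_denom;
  by rewrite /r1 /s1 /s2 /orient; ring.
Qed.

(** The pairs of a vertex in the arc from b to a and an outer neighbour of it
    give different edges, because the two arcs are disjoint. *)
Lemma sum_outer_le_crosses (e : rel T) a b : convex_position p -> e a b ->
  (\sum_(v in arc ccw b a) outer_degree ccw e a b v
   <= #|[set F in edges e | `[< crosses p [set a; b] F >]]|)%N.
Proof.
move=> pos eab.
have CO := ccw_cyclic_order pos.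
rewrite /outer_degree
  (eq_bigr (fun v => \sum_(u | (u \in arc ccw a b) && e v u) 1)%N);
  last by move=> v _; rewrite -sum1_card; apply: eq_bigl => u; rewrite inE.
rewrite pair_big_dep sum1_card /=.
set P := (X in #|X|).
have disj v u : v \in arc ccw b a -> u \in arc ccw a b -> v != u.
  move=> vba uab; apply/eqP => vu; move: (arc_ends_disjoint CO vba).
  by rewrite vu uab.
have nab v u : v \in arc ccw b a -> [set a; b] <> [set v; u].
  rewrite inE => Cbva E; have : v \in [set a; b] by rewrite E set21.
  rewrite !inE (negPf (cyc_neq12 CO (cyc_rot CO Cbva))) eq_sym.
  by rewrite (negPf (cyc_neq12 CO Cbva)).
rewrite -(card_in_imset (f := fun vu => [set vu.1; vu.2])); last first.
  move=> [v u] [v' u'] /= /andP[vba /andP[uab _]] /andP[v'ba /andP[u'ab _]] E.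
  have : v \in [set v'; u'] by rewrite -E set21.
  have : u \in [set v'; u'] by rewrite -E set22.
  rewrite !inE (negPf (disj _ _ vba u'ab)) (eq_sym u v').
  by rewrite (negPf (disj _ _ v'ba uab)) orbF /= => /eqP-> /eqP->.
apply/subset_leq_card/subsetP => F /imsetP[[v u] /andP[vba /andP[uab evu]] ->].
rewrite inE; apply/andP; split.
  by apply/imset2P; exists v u; rewrite ?inE.
by apply/asboolP; split; [apply: nab | apply: chords_cross].
Qed.

End Position.

(** * The minimum degree *)

Lemma min_degree_le (T : finType) (e : rel T) v :
  (min_degree e <= degree e v)%N.
Proof.
rewrite /min_degree; elim: (index_enum T) (mem_index_enum v) => // u s IH.
rewrite inE big_cons geq_min; case: eqVneq => [->|_ /= /IH->].
  by rewrite leqnn.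
by rewrite orbT.
Qed.

Lemma min_degree_le_card (T : finType) (e : rel T) : (min_degree e <= #|T|)%N.
Proof.
rewrite /min_degree; elim/big_rec: _ => // v n _ nT.
by rewrite geq_min nT orbT.
Qed.

Theorem theorem23 (R : realType) :
  exists k0 : nat, forall k : nat, (k0 <= k)%N ->
  forall (T : finType) (e : rel T),
    symmetric e -> irreflexive e ->
    outer_k_planar R k e -> bipartite e ->
    ((min_degree e)%:R : R)
      <= 2 * Num.sqrt (8 / 11) * Num.sqrt (k%:R) + 2.
Proof.
exists 0%N => k _ T e e_sym _ [p [pos kpl]] bip.
set d := min_degree e.
have rhs_ge0 : 0 <= 2 * Num.sqrt (8 / 11) * Num.sqrt k%:R :> R.
  by rewrite !mulr_ge0 ?sqrtr_ge0.
have [d2|d3] := leqP d 2.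
  by apply: (@le_trans _ _ 2%:R); rewrite ?ler_nat // lerDr.
have T0 : (0 < #|T|)%N by apply: leq_trans (min_degree_le_card e); lia.
have [a [b [eab heavy]]] :=
  exists_heavy_edge (ccw_cyclic_order pos) e_sym bip d3 (min_degree_le e) T0.
have ab_edge : [set a; b] \in edges e.
  by apply/imset2P; exists a b; rewrite ?inE.
have dk : (11 * (d - 2) ^ 2 <= 32 * k)%N.
  apply: leq_trans heavy _; rewrite leq_mul2l /=.
  exact: leq_trans (sum_outer_le_crosses pos eab) (kpl _ ab_edge).
rewrite -(subnK (ltnW d3)) natrD lerD2r -ler_sqr ?nnegrE ?ler0n //.
rewrite !exprMn !sqr_sqrtr ?ler0n ?divr_ge0 ?ler0n //.
move: dk; rewrite -(ler_nat R) !natrM -expr2; lra.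
Qed.
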